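(* Let $\mathbf{M}$ be an $m\times n$ interval matrix with the strong Monge property and $\mathbf{N}$ an $m\times n$ interval matrix with the weak Monge property. Then: (1) $\mathbf{M}+\mathbf{N}$ has the weak Monge property; (2) if $\mathbf{m}_{ij}\cap\mathbf{n}_{ij}\ne\emptyset$ for all $i,j$, then $\mathbf{M}\cap\mathbf{N}$ has the weak Monge property; (3) $\square(\mathbf{M}\cup\mathbf{N})$ has the weak Monge property.
   Context: An interval matrix $\mathbf{M}=[\underline{M},\overline{M}]$ with real $m\times n$ matrices $\underline{M}\le\overline{M}$ is the set $\{A\in\mathbb{R}^{m\times n}:\underline{M}\le A\le\overline{M}\}$ (entrywise), with entries $\mathbf{m}_{ij}=[\underline{m}_{ij},\overline{m}_{ij}]$. Operations: $\mathbf{M}+\mathbf{N}=[\underline{M}+\underline{N},\overline{M}+\overline{N}]$; $\mathbf{M}\cap\mathbf{N}$ is the interval matrix with entries $[\max\{\underline m_{ij},\underline n_{ij}\},\min\{\overline m_{ij},\overline n_{ij}\}]$; $\square(\mathbf{M}\cup\mathbf{N})=[\min\{\underline M,\underline N\},\max\{\overline M,\overline N\}]$ (entrywise). A real matrix $A$ is Monge if $a_{ij}+a_{k\ell}\le a_{i\ell}+a_{kj}$ for all $i<k$, $j<\ell$. An interval matrix has the strong Monge property if every matrix it contains is Monge, and the weak Monge property if it contains some Monge matrix. *)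

(* Defs.v *)
From mathcomp Require Import all_boot all_order all_algebra.
From mathcomp Require Import reals.
Set Implicit Arguments.
Unset Strict Implicit.
Unset Printing Implicit Defensive.
Import Order.TTheory GRing.Theory Num.Theory.
Local Open Scope ring_scope.

Record interval_mx (R : realType) (m n : nat) := IntervalMx {
  imx_lo : 'M[R]_(m, n);
  imx_hi : 'M[R]_(m, n);
  imx_lo_le_hi : forall i j, imx_lo i j <= imx_hi i j }.

Definition imx_entry (R : realType) (m n : nat) (M : interval_mx R m n)
    (i : 'I_m) (j : 'I_n) : interval R :=
  `[imx_lo M i j, imx_hi M i j].

Definition imx_mem (R : realType) (m n : nat) (M : interval_mx R m n)
    (A : 'M[R]_(m, n)) : Prop :=
  forall i j, A i j \in imx_entry M i j.

Definition monge (R : realType) (m n : nat) (A : 'M[R]_(m, n)) : Prop :=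
  forall (i k : 'I_m) (j l : 'I_n), (i < k)%N -> (j < l)%N ->
    A i j + A k l <= A i l + A k j.

Definition strong_monge (R : realType) (m n : nat) (M : interval_mx R m n) : Prop :=
  forall A, imx_mem M A -> monge A.

Definition weak_monge (R : realType) (m n : nat) (M : interval_mx R m n) : Prop :=
  exists A, imx_mem M A /\ monge A.

Section Operations.
Variables (R : realType) (m n : nat) (M N : interval_mx R m n).

Fact imx_add_subproof i j :
  (imx_lo M + imx_lo N) i j <= (imx_hi M + imx_hi N) i j.
Proof. by rewrite !mxE lerD ?imx_lo_le_hi. Qed.

Definition imx_add : interval_mx R m n := IntervalMx imx_add_subproof.

Definition imx_meets : Prop :=
  forall i j, exists x : R, x \in imx_entry M i j /\ x \in imx_entry N i j.

(* [max of lower bounds, min of upper bounds] is a genuine interval matrix only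
   when corresponding entries intersect, so the operation takes a proof of it. *)
Fact imx_cap_subproof (MN : imx_meets) i j :
  (\matrix_(i, j) Num.max (imx_lo M i j) (imx_lo N i j)) i j <=
  (\matrix_(i, j) Num.min (imx_hi M i j) (imx_hi N i j)) i j.
Proof.
have [x [/itvP xM /itvP xN]] := MN i j.
by rewrite !mxE (@le_trans _ _ x) // ?ge_max ?le_min ?xM ?xN.
Qed.

Definition imx_cap (MN : imx_meets) : interval_mx R m n :=
  IntervalMx (imx_cap_subproof MN).

Fact imx_hull_subproof i j :
  (\matrix_(i, j) Num.min (imx_lo M i j) (imx_lo N i j)) i j <=
  (\matrix_(i, j) Num.max (imx_hi M i j) (imx_hi N i j)) i j.
Proof. by rewrite !mxE ge_min !le_max imx_lo_le_hi. Qed.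

Definition imx_hull : interval_mx R m n := IntervalMx imx_hull_subproof.

End Operations.

(* Main.v *)
Require Import Defs.
From mathcomp Require Import all_boot all_order all_algebra.
From mathcomp Require Import reals.
Import Order.TTheory GRing.Theory Num.Theory.
Local Open Scope ring_scope.

(** Each claim needs one Monge witness. Every member of [M] is Monge, in particular [imx_lo M].
    Adding it to a Monge member of [N] settles the sum, by [monge_add]. The intersection lies inside
    [M], so all its members are Monge ([imx_mem_capl]). The hull contains [N], so it inherits the
    Monge member of [N] ([imx_mem_hullr]). *)

Lemma imx_memP (R : realType) (m n : nat) (M : interval_mx R m n)
    (A : 'M[R]_(m, n)) :
  imx_mem M A <-> forall i j, imx_lo M i j <= A i j <= imx_hi M i j.
Proof. by split=> h i j; have := h i j; rewrite /imx_entry in_itv. Qed.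

Lemma imx_mem_lo (R : realType) (m n : nat) (M : interval_mx R m n) :
  imx_mem M (imx_lo M).
Proof. by apply/imx_memP => i j; rewrite lexx imx_lo_le_hi. Qed.

Lemma monge_add (R : realType) (m n : nat) (A B : 'M[R]_(m, n)) :
  monge A -> monge B -> monge (A + B).
Proof.
(* Both sides are regrouped to separate the entries of [A] from those of [B]; the two Monge
   inequalities then add up. *)
move=> hA hB i k j l ik jl; rewrite !mxE addrACA [leRHS]addrACA.
exact: lerD (hA _ _ _ _ ik jl) (hB _ _ _ _ ik jl).
Qed.

Lemma imx_mem_add (R : realType) (m n : nat) (M N : interval_mx R m n)
    (A B : 'M[R]_(m, n)) :
  imx_mem M A -> imx_mem N B -> imx_mem (imx_add M N) (A + B).
Proof.
move=> /imx_memP hA /imx_memP hB; apply/imx_memP => i j; rewrite !mxE.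
have /andP[? ?] := hA i j; have /andP[? ?] := hB i j.
by rewrite !lerD.
Qed.

Lemma imx_mem_capl (R : realType) (m n : nat) (M N : interval_mx R m n)
    (MN : imx_meets M N) (A : 'M[R]_(m, n)) :
  imx_mem (imx_cap MN) A -> imx_mem M A.
Proof.
move=> /imx_memP hA; apply/imx_memP => i j; have := hA i j.
by rewrite !mxE ge_max le_min => /andP[/andP[-> _] /andP[-> _]].
Qed.

Lemma imx_mem_hullr (R : realType) (m n : nat) (M N : interval_mx R m n)
    (A : 'M[R]_(m, n)) :
  imx_mem N A -> imx_mem (imx_hull M N) A.
Proof.
move=> /imx_memP hA; apply/imx_memP => i j; have /andP[loA Ahi] := hA i j.
by rewrite !mxE ge_min le_max loA Ahi !orbT.
Qed.

Theorem theorem5p3 (R : realType) (m n : nat) (M N : interval_mx R m n)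
    (hM : strong_monge M) (hN : weak_monge N) :
  weak_monge (imx_add M N) /\
  (forall MN : imx_meets M N, weak_monge (imx_cap MN)) /\
  weak_monge (imx_hull M N).
Proof.
have [B [NB mongeB]] := hN; split; [|split=> [MN|]].
- exists (imx_lo M + B); split; first exact: imx_mem_add (imx_mem_lo _ _ _ M) NB.
  exact: monge_add (hM _ (imx_mem_lo _ _ _ M)) mongeB.
(* Any member would do; the lower bound is one because [MN] keeps every entry interval nonempty. *)
- exists (imx_lo (imx_cap MN)); split; first exact: imx_mem_lo.
  by apply: hM; apply: imx_mem_capl (imx_mem_lo _ _ _ (imx_cap MN)).
- by exists B; split=> //; exact: imx_mem_hullr.
Qed.
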